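(* Let $m\ge 1$ and let $F_m(t,x,y,z)=\sum_{n\ge 0}f_n(x,y,z)\,t^n$ be the rational generating function for the weighted matchings of the $m$ by $n$ rectangular grid graphs. Then, as an identity of rational functions in $t,x,y,z$, $$x^m t^2 F_m(t,x,y,z)=-F_m\Bigl(\frac{1}{t x^m},\,x,\,-y,\,-z\Bigr).$$
   Context: Fix $m\ge1$. For $n>0$, let $G(m,n)$ be the rectangular grid graph with $m$ rows and $n$ columns of vertices, with horizontal edges joining horizontally neighbouring vertices and vertical edges joining vertically neighbouring vertices. A matching $\mu$ of $G(m,n)$ is a set of edges no two of which share a vertex, together with all vertices not incident with any of those edges (isolated vertices). The weight of $\mu$ is $w(\mu)=x^{h}y^{v}z^{s}$, where $h$, $v$, $s$ are the numbers of horizontal edges, vertical edges and isolated vertices in $\mu$, and $x,y,z$ are formal variables. Set $f_n(x,y,z)=\sum_{\mu}w(\mu)$, the sum over all matchings of $G(m,n)$, and $f_0=1$. The formal power series $F_m(t,x,y,z)=\sum_{n\ge0}f_n(x,y,z)t^n$ is the expansion at $t=0$ of a rational function of $t,x,y,z$, which is also denoted $F_m$; substitutions into $F_m$ refer to this rational function. *)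

(* Defs.v *)
From HB Require Import structures.
From mathcomp Require Import all_boot all_order all_algebra.
From mathcomp Require Import mpoly.

Set Implicit Arguments.
Unset Strict Implicit.
Unset Printing Implicit Defensive.

Import GRing.Theory.
Local Open Scope ring_scope.
Local Open Scope quotient_scope.

Local Notation "p %:F" := (FracField.tofrac p) : ring_scope.

Section Grid.
Variables m n : nat.

(* The vertex (i, j) lies in row i and column j. *)
Definition vertex : finType := ('I_m * 'I_n)%type.

Definition hadj (u w : vertex) : bool :=
  (u.1 == w.1) && (w.2 == u.2.+1 :> nat).
Definition vadj (u w : vertex) : bool :=
  (u.2 == w.2) && (w.1 == u.1.+1 :> nat).

Definition hedges : {set {set vertex}} :=
  [set [set u; w] | u in [set: vertex], w in hadj u].
Definition vedges : {set {set vertex}} :=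
  [set [set u; w] | u in [set: vertex], w in vadj u].

(* A matching is represented by its set of edges, which determines its set of
   isolated vertices. *)
Definition matching (M : {set {set vertex}}) : bool :=
  (M \subset hedges :|: vedges) && trivIset M.

Definition isolated (M : {set {set vertex}}) : {set vertex} := ~: cover M.

Definition weight (M : {set {set vertex}}) : {mpoly rat[3]} :=
  'X_0 ^+ #|M :&: hedges| * 'X_1 ^+ #|M :&: vedges| * 'X_2 ^+ #|isolated M|.

End Grid.

Definition matching_poly (m n : nat) : {mpoly rat[3]} :=
  if n == 0%N then 1
  else \sum_(M : {set {set vertex m n}} | matching M) weight M.

(* Q(t, x, y, z), built as the fraction field of Q[x, y, z][t]. *)
Definition ratfun : fieldType := {fraction {poly {mpoly rat[3]}}}.

Definition tR : ratfun := 'X%:F.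
Definition xR : ratfun := ('X_0)%:P%:F.
Definition yR : ratfun := ('X_1)%:P%:F.
Definition zR : ratfun := ('X_2)%:P%:F.

(* F is regular at t = 0 and its Taylor expansion there is
   \sum_n (f n) t^n: F = P / Q with Q(0) != 0 and Q * (\sum_n (f n) t^n) = P
   coefficientwise. *)
Definition expansion_at0 (F : ratfun) (f : nat -> {mpoly rat[3]}) : Prop :=
  exists P Q : {poly {mpoly rat[3]}},
    [/\ Q`_0 != 0,
        F = P%:F / Q%:F
      & forall n : nat, \sum_(k < n.+1) Q`_k * f (n - k)%N = P`_n].

Definition is_genfun (m : nat) (F : ratfun) : Prop :=
  expansion_at0 F (matching_poly m).

Section Substitution.
Variables t x y z : ratfun.

Definition poly_subst (p : {poly {mpoly rat[3]}}) : ratfun :=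
  (map_poly (mmap (@FracField.tofrac _ \o polyC \o @mpolyC 3 rat)
                  (tnth [tuple x; y; z])) p).[t].

(* F(t, x, y, z), computed on a chosen representative of F. When t, x, y, z are
   algebraically independent, as hypothesized in rat_substE, no denominator
   vanishes and the value does not depend on the representative. *)
Definition rat_subst (F : ratfun) : ratfun :=
  poly_subst (frac (repr F)).1 / poly_subst (frac (repr F)).2.

Lemma poly_substM p q : poly_subst (p * q) = poly_subst p * poly_subst q.
Proof. by rewrite /poly_subst rmorphM hornerM. Qed.

Lemma frac_repr (F : ratfun) :
  F = (frac (repr F)).1%:F / (frac (repr F)).2%:F.
Proof.
rewrite -[LHS]reprK; case: (repr F) => -[a b] /= b0; unlock FracField.tofrac.
rewrite -[X in _ * X]FracField.pi_inv -[RHS]FracField.pi_mul.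
rewrite /FracField.mulf /FracField.invf !numden_Ratio ?oner_neq0 //.
rewrite mulr1 mul1r; congr (\pi _).
by apply/val_inj; rewrite /= [RHS]surjective_pairing !numden_Ratio.
Qed.

Lemma rat_substE (p q : {poly {mpoly rat[3]}}) :
    (forall r, poly_subst r = 0 -> r = 0) -> q != 0 ->
  rat_subst (p%:F / q%:F)
    = poly_subst p / poly_subst q.
Proof.
move=> inj q0; set F : ratfun := _ / _.
have nz r : r != 0 -> poly_subst r != 0.
  by apply: contra => /eqP/inj->.
have := frac_repr F; rewrite /rat_subst.
case: (repr F) => -[a b] /= b0 /eqP; rewrite /F.
rewrite eqr_div ?tofrac_eq0 // -!tofracM tofrac_eq => /eqP E.
by apply/eqP; rewrite eqr_div ?nz // -!poly_substM -E mulrC.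
Qed.

End Substitution.

(* Main.v *)
From HB Require Import structures.
Require Import Defs.
From mathcomp Require Import all_boot all_order all_algebra.
From mathcomp Require Import mpoly.

(** Cut a matching of the m by n grid between consecutive columns, and record
which rows are crossed by a horizontal edge at each cut. A column whose left
and right crossing sets are A and B requires A and B to be disjoint; it then
contributes x^|B| for the edges leaving to the right and the matching
polynomial h(~(A u B)) of the remaining vertices of a vertical path, as in
[transfer]. Hence f_n is the (0, 0) entry of T^n, where T is the transfer
matrix indexed by the subsets of the rows and 0 stands for the empty set
([matching_poly_transfer]), and F_m is the (0, 0) entry of (1 - t T)^-1.

Reciprocity comes from the shape of T^-1. Regard functions of vertex sets as
elements of an algebra whose product is sum over A included in S of
f(A) g(S \ A). In this algebra h is the exponential of the function with value
y on vertical edges and z on singletons, so changing the signs of y and z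
inverts h. For the transfer matrix T' of (x, -y, -z) this says that x^m T'^-1
is the transpose of T with rows and columns relabelled by complementation
([transfer_inverse]). Substituting 1 / (t x^m) for t thus turns the resolvent of T'
at the empty set into 1 minus the resolvent of T at the full set
([resolvent_reciprocity]); and since a full crossing set forces the next one to
be empty and the previous one to be empty, with weight x^m, the latter entry is
1 + x^m t^2 F_m.

Matchings are handled throughout as set partitions: an isolated vertex is a
block of size 1. The exponential property is then [psumD], which also provides
every decomposition of matchings that is needed. *)

Set Implicit Arguments.
Unset Strict Implicit.
Unset Printing Implicit Defensive.

Import GRing.Theory.
Local Open Scope ring_scope.

(** * Weighted sums over set partitions *)

Section PartitionSum.
Variables (V : finType) (R : comNzRingType).
Implicit Types (w : {set V} -> R) (S A C : {set V}) (M J : {set {set V}}).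

Definition psum w S : R :=
  \sum_(M : {set {set V}} | partition M S) \prod_(b in M) w b.

Lemma psum_set0 w : psum w set0 = 1.
Proof.
by rewrite /psum (big_pred1 set0) ?big_set0 // => M; rewrite partition_set0.
Qed.

Lemma psum0 S : psum (fun=> 0) S = (S == set0)%:R.
Proof.
have [->|S0] := eqVneq S set0.
  exact: psum_set0.
rewrite /psum big1 // => M parM.
have [M0|/set0Pn[b bM]] := eqVneq M set0.
  by move: parM S0; rewrite M0 /partition /cover big_set0 eq_sym => /andP[->].
by rewrite (bigD1 b) //= mul0r.
Qed.

Lemma eq_psum w w' S :
  (forall b, b != set0 -> b \subset S -> w b = w' b) -> psum w S = psum w' S.
Proof.
move=> eqw; apply: eq_bigr => M parM; apply: eq_bigr => b bM.
apply: eqw; first by have [_ _] := and3P parM; apply: contra => /eqP <-.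
by rewrite -(cover_partition parM) (bigcup_max b).
Qed.

(** Splitting the set of blocks and splitting the underlying set are the same
thing: this lemma and the next one are the two directions. *)
Lemma partition_sub M S J : partition M S -> J \subset M ->
  [/\ partition J (cover J), partition (M :\: J) (S :\: cover J)
    & cover J \subset S].
Proof.
move=> /and3P[/eqP cM tM nM] JM.
have tJ := trivIsetS JM tM.
have nJ : set0 \notin J by apply: contra nM; apply/subsetP.
have MJ : M :\: J \subset M by apply: subsetDl.
split.
- by rewrite /partition eqxx tJ nJ.
- apply/and3P; split; first 1 last.
  + exact: trivIsetS MJ tM.
  + by apply: contra nM; apply/subsetP.
  apply/eqP/setP=> v; rewrite inE; apply/bigcupP/andP=> [[b]|[vJ]].
    rewrite inE => /andP[bJ bM] vb; split; last first.
      by rewrite -cM; apply/bigcupP; exists b.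
    apply/bigcupP=> -[c cJ vc].
    have cb : c != b by apply: contraNneq bJ => <-.
    move/trivIsetP: tM => /(_ c b (subsetP JM _ cJ) bM cb).
    by move/disjoint_setI0/setP/(_ v); rewrite !inE vc vb.
  rewrite -cM => /bigcupP[b bM vb]; exists b => //.
  rewrite inE bM andbT; apply: contra vJ => bJ.
  by apply/bigcupP; exists b.
- by rewrite -cM; apply/bigcupsP => b bJ; rewrite (bigcup_max b) // (subsetP JM).
Qed.

Lemma partition_join M1 M2 A S : A \subset S ->
  partition M1 A -> partition M2 (S :\: A) ->
  partition (M1 :|: M2) S /\ [disjoint M1 & M2].
Proof.
move=> AS /and3P[/eqP c1 t1 n1] /and3P[/eqP c2 t2 n2].
have cc : [disjoint cover M1 & cover M2].
  by rewrite c1 c2 -setI_eq0 setIDA setIC -setIDA setDv setI0.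
split.
  apply/and3P; split.
  - rewrite /cover bigcup_setU -!/(cover _) c1 c2.
    by rewrite -{1}(setIidPr AS) setID.
  - exact: trivIsetU.
  - by rewrite inE negb_or n1.
apply/pred0P=> b; apply/andP=> -[b1 b2].
have /set0Pn[v vb] : b != set0 by apply: contraNneq n1 => <-.
have v1 : v \in cover M1 by apply/bigcupP; exists b.
have v2 : v \in cover M2 by apply/bigcupP; exists b.
by move: (disjointFr cc v1); rewrite v2.
Qed.

(** A set partition J determines the set it covers, so a sum over a set A and
then over the partitions of A is a single sum over J. *)
Lemma big_psum w (g : {set V} -> R) S :
  \sum_(A : {set V} | A \subset S) psum w A * g A =
  \sum_(J : {set {set V}} | partition J (cover J) && (cover J \subset S))
     (\prod_(b in J) w b) * g (cover J).
Proof.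
rewrite (partition_big (@cover V) (fun A => A \subset S)) /=; last first.
  by move=> J /andP[].
apply: eq_bigr => A AS; rewrite mulr_suml.
apply: eq_big => [J|J /andP[/eqP-> _] //].
apply/idP/andP=> [parJ|[/andP[parJ _] /eqP <-] //].
by rewrite (cover_partition parJ) AS parJ.
Qed.

(** [psum] is the exponential for the product of set functions on the right:
expanding each product of sums assigns every block of a partition to w or to
w', and the blocks assigned to w form a partition of the set A. Taking w' := - w
inverts [psum w], and taking w and w' with disjoint supports splits a matching
into two kinds of blocks. *)
Lemma psumD w w' S : psum (fun b => w b + w' b) S =
  \sum_(A : {set V} | A \subset S) psum w A * psum w' (S :\: A).
Proof.
pose G J M := (\prod_(b in J) w b) * \prod_(b in M :\: J) w' b.
transitivity (\sum_(M : {set {set V}} | partition M S)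
    \sum_(J : {set {set V}} | J \subset M) G J M).
  apply: eq_bigr => M _; rewrite big_mkcond /=.
  (* The neutral values 0 and 1 outside M make the product over all blocks
     expand over subsets of M only. *)
  pose F b := if b \in M then w b else 0.
  pose F' b := if b \in M then w' b else 1.
  transitivity (\prod_b (F b + F' b)).
    by apply: eq_bigr => b _; rewrite /F /F'; case: ifP; rewrite ?add0r.
  rewrite bigA_distr [LHS](bigID (fun J => J \subset M)) /=.
  rewrite [X in _ + X]big1 ?addr0 => [|J /subsetPn[b bJ bM]]; last first.
    by rewrite (bigD1 b) //= bJ /F (negPf bM) mul0r.
  apply: eq_bigr => J JM.
  rewrite [LHS](bigID (mem J)) /=; congr (_ * _).
    by apply: eq_bigr => b bJ; rewrite bJ /F (subsetP JM).
  rewrite big_mkcond [RHS]big_mkcond; apply: eq_bigr => b _.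
  by rewrite inE /F'; case: (b \in J).
rewrite (exchange_big_dep predT) //=.
rewrite big_psum (bigID (fun J => partition J (cover J) && (cover J \subset S))).
rewrite /= [X in _ + X]big1 ?addr0 => [|J badJ]; last first.
  apply: big_pred0 => M; apply: contraNF badJ => /andP[parM JM].
  by have [-> _ ->] := partition_sub parM JM.
apply: eq_bigr => J /andP[parJ JS]; rewrite mulr_sumr.
rewrite (reindex_onto (fun M2 => J :|: M2) (fun M => M :\: J)) /=; last first.
  by move=> M /andP[_ JM]; rewrite -{1}(setIidPr JM) setID.
apply: eq_big => [M2|M2 /andP[_ /eqP E]]; last by rewrite /G E.
rewrite subsetUl andbT; apply/andP/idP=> [[parM /eqP E]|parM2].
  by have [_] := partition_sub parM (subsetUl J M2); rewrite E.
have [-> dJ] := partition_join JS parJ parM2; split=> //.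
by rewrite setDUl setDv set0U (setDidPl _) // disjoint_sym.
Qed.

(** Apply [psumD] to the restrictions of w to the subsets of C and to the other
blocks: unless A is S :&: C, every partition in one of the two factors has a
block of weight 0. *)
Lemma psum_split w C S :
  (forall b : {set V}, b \subset S -> w b != 0 -> (b \subset C) || [disjoint b & C]) ->
  psum w S = psum w (S :&: C) * psum w (S :\: C).
Proof.
move=> wC.
pose wi (b : {set V}) := if b \subset C then w b else 0.
pose wo (b : {set V}) := if b \subset C then 0 else w b.
have z0 (w' : {set V} -> R) b M A : partition M A -> b \in M -> w' b = 0 ->
    \prod_(c in M) w' c = 0 by move=> _ bM b0; rewrite (bigD1 b) //= b0 mul0r.
transitivity (psum (fun b => wi b + wo b) S).
  by apply: eq_psum => b _ _; rewrite /wi /wo; case: ifP; rewrite ?addr0 ?add0r.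
rewrite psumD (bigD1 (S :&: C)) ?subsetIl //= big1 ?addr0 => [|A].
  congr (_ * _); last first.
    rewrite setDIr setDv set0U; apply: eq_psum => b b0 bSC; rewrite /wo.
    case: ifP => // bC; case/negP: b0; rewrite -subset0 -(setDv C).
    by rewrite subsetD bC; move: bSC; rewrite subsetD => /andP[].
  by apply: eq_psum => b _; rewrite /wi subsetI => /andP[_ ->].
case/andP=> AS AC; have [AsC|/subsetPn[v vA vC]] := boolP (A \subset C).
  have /subsetPn[v /setIP[vS vC] vA] : ~~ (S :&: C \subset A).
    by apply: contra AC => SA; rewrite eqEsubset SA subsetI AS AsC.
  suff -> : psum wo (S :\: A) = 0 by rewrite mulr0.
  apply: big1 => M parM.
  have : v \in cover M by rewrite (cover_partition parM) !inE vA.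
  case/bigcupP=> b bM vb; apply: (z0 _ _ _ _ parM bM); rewrite /wo.
  case: ifP => // /negbT bC; apply/eqP; apply: contraNT bC => /wC.
  rewrite (subset_trans (partitionS parM bM)) ?subsetDl // => /(_ isT).
  by case/orP=> // /disjoint_setI0/setP/(_ v); rewrite !inE vb vC.
suff -> : psum wi A = 0 by rewrite mul0r.
apply: big1 => M parM.
have : v \in cover M by rewrite (cover_partition parM).
case/bigcupP=> b bM vb; apply: (z0 _ _ _ _ parM bM); rewrite /wi.
by case: ifP => // /subsetP/(_ _ vb); rewrite (negPf vC).
Qed.

(** A set covered by members of a disjoint family is covered in only one way,
so [psum] degenerates to a product. This serves for singletons and for the
horizontal edges between two given columns. *)
Lemma big_psum_family (I : finType) (F : I -> {set V}) w (g : {set V} -> R) S :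
    (forall i j, i != j -> [disjoint F i & F j]) ->
    (forall i, F i != set0) ->
    (forall b, w b != 0 -> b \in codom F) ->
  \sum_(A : {set V} | A \subset S) psum w A * g A =
  \sum_(B : {set I} | \bigcup_(i in B) F i \subset S)
     (\prod_(i in B) w (F i)) * g (\bigcup_(i in B) F i).
Proof.
move=> disF F0 wF; rewrite big_psum.
have injF : injective F.
  move=> i j Fij; apply: contraTeq isT => /disF.
  by rewrite Fij -setI_eq0 setIid (negPf (F0 j)).
rewrite (bigID (fun J => J \subset codom F)) /= [X in _ + X]big1 ?addr0; last first.
  move=> J /andP[_ /subsetPn[b bJ bF]]; rewrite (bigD1 b) //=.
  by rewrite (eqP (contraNT (@wF b) bF)) !mul0r.
rewrite (reindex_onto (fun B : {set I} => F @: B) (fun J => F @^-1: J)) /=; last first.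
  move=> J /andP[_ /subsetP JF]; apply/setP=> b; apply/imsetP/idP.
    by case=> i; rewrite inE => ? ->.
  by move=> bJ; have /codomP[i bi] := JF _ bJ; exists i; rewrite ?inE -?bi.
have cF (B : {set I}) : cover (F @: B) = \bigcup_(i in B) F i.
  by rewrite /cover big_imset //= => i j _ _; apply: injF.
apply: eq_big => [B|B _]; last first.
  by rewrite cF big_imset //= => i j _ _; apply: injF.
rewrite cF -andbA andbC -andbA -cF.
have -> : F @^-1: (F @: B) == B.
  by apply/eqP/setP=> i; rewrite inE mem_imset.
have -> : F @: B \subset codom F.
  by apply/subsetP=> _ /imsetP[i _ ->]; apply: codom_f.
have [-> _] : partition (F @: B) (cover (F @: B)) /\ {in B &, injective F}.
  by apply: indexed_partition => [i j _ _ ji|i _]; rewrite ?F0 // disF // eq_sym.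
by [].
Qed.
End PartitionSum.

Lemma psum_imset (V V' : finType) (R : comNzRingType) (f : V -> V')
    (w : {set V'} -> R) (S : {set V}) : injective f ->
  psum w (f @: S) = psum (fun b => w (f @: b)) S.
Proof.
move=> injf; pose F (b : {set V}) : {set V'} := f @: b.
have injF : injective F := imset_inj injf.
rewrite /psum (reindex_onto (fun M : {set {set V}} => F @: M)
  (fun M => F @^-1: M)) /=; last first.
  move=> M parM; apply/setP=> b; apply/imsetP/idP.
    by case=> c; rewrite inE => ? ->.
  move=> bM; have bS := partitionS parM bM.
  have E : b = F (f @^-1: b).
    apply/setP=> v; apply/idP/imsetP=> [vb|[u]].
      by have /imsetP[u _ vu] := subsetP bS _ vb; exists u; rewrite ?inE -?vu.
    by rewrite inE => ? ->.
  by exists (f @^-1: b) => //; rewrite inE -E.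
apply: eq_big => [M|M _]; last by rewrite big_imset //= => b c _ _; apply: injF.
have -> : F @^-1: (F @: M) == M by apply/eqP/setP=> b; rewrite inE mem_imset.
by rewrite andbT imset_partition.
Qed.

Lemma rmorph_psum (V : finType) (R R' : comNzRingType) (f : {rmorphism R -> R'})
    (w : {set V} -> R) (S : {set V}) :
  f (psum w S) = psum (fun b => f (w b)) S.
Proof.
by rewrite /psum rmorph_sum; apply: eq_bigr => M _; rewrite rmorph_prod.
Qed.

(** * Edges of the grid *)

Section Edges.
Variables m n : nat.
Implicit Type b : {set vertex m n}.

Lemma hedgesP b : reflect
  (exists i (j j' : 'I_n), j' = j.+1 :> nat /\ b = [set (i, j); (i, j')])
  (b \in hedges m n).
Proof.
apply: (iffP imset2P) => [[[i j] [i' j'] _]|[i [j [j' [jj' ->]]]]].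
  by rewrite unfold_in /hadj /= => /andP[/eqP <- /eqP jj'] ->; exists i, j, j'.
by exists (i, j) (i, j'); rewrite ?inE // unfold_in /hadj /= jj' !eqxx.
Qed.

Lemma vedgesP b : reflect
  (exists (i i' : 'I_m) j, i' = i.+1 :> nat /\ b = [set (i, j); (i', j)])
  (b \in vedges m n).
Proof.
apply: (iffP imset2P) => [[[i j] [i' j'] _]|[i [i' [j [ii' ->]]]]].
  by rewrite unfold_in /vadj /= => /andP[/eqP <- /eqP ii'] ->; exists i, i', j.
by exists (i, j) (i', j); rewrite ?inE // unfold_in /vadj /= ii' !eqxx.
Qed.

Lemma hedges_not_vedges b : b \in hedges m n -> b \notin vedges m n.
Proof.
move=> /hedgesP[i [j [j' [jj' ->]]]]; apply/vedgesP=> -[k [k' [l [_ E]]]].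
have: (i, j) \in [set (k, l); (k', l)] by rewrite -E !inE eqxx.
have: (i, j') \in [set (k, l); (k', l)] by rewrite -E !inE eqxx orbT.
rewrite !inE !xpair_eqE -!andb_orl => /andP[_ /eqP jl] /andP[_ /eqP jl'].
by move: jj'; rewrite jl jl' => /eqP; rewrite -[X in X == _]addn0 -addn1 eqn_add2l.
Qed.

Lemma card_edge b : b \in hedges m n :|: vedges m n -> #|b| = 2.
Proof.
case/setUP=> [/hedgesP[i [j [j' [jj' ->]]]]|/vedgesP[i [i' [j [ii' ->]]]]].
  rewrite cards2 xpair_eqE eqxx /=; suff -> : j != j' by [].
  by rewrite -val_eqE /= jj' neq_ltn ltnSn.
rewrite cards2 xpair_eqE eqxx andbT; suff -> : i != i' by [].
by rewrite -val_eqE /= ii' neq_ltn ltnSn.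
Qed.
End Edges.

(** * Transfer between consecutive columns *)

Section Transfer.
Variables (R : comNzRingType) (m : nat) (x y z : R).

Definition path_weight (b : {set 'I_m}) : R :=
  if #|b| == 1 then z
  else if [exists i : 'I_m, exists k : 'I_m, (k == i.+1 :> nat) && (b == [set i; k])]
  then y else 0.

Definition path_poly (S : {set 'I_m}) : R := psum path_weight S.

Definition transfer (A B : {set 'I_m}) : R :=
  if [disjoint A & B] then x ^+ #|B| * path_poly (~: (A :|: B)) else 0.

Section Grid.
Variable n : nat.
Implicit Types (b S : {set vertex m n}) (A B : {set 'I_m}).

(** The tests exclude each other, by [card_edge] and [hedges_not_vedges]; a block
of size 1 stands for an isolated vertex. *)
Definition block_weight b : R :=
  if #|b| == 1 then z
  else if b \in hedges m n then x
  else if b \in vedges m n then y else 0.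

Lemma block_weight_column (j : 'I_n) (c : {set 'I_m}) :
  block_weight ((pair^~ j) @: c) = path_weight c.
Proof.
have injj : injective ((pair : 'I_m -> 'I_n -> vertex m n)^~ j) by move=> i k [].
rewrite /block_weight /path_weight card_imset //; case: ifP => // _.
case: ifP => [/hedgesP[i [k [k' [kk' E]]]]|_].
  have: (i, k) \in [set (i, j) | i in c] by rewrite E !inE eqxx.
  have: (i, k') \in [set (i, j) | i in c] by rewrite E !inE eqxx orbT.
  move=> /imsetP[? _ [_ jk]] /imsetP[? _ [_ jk']].
  by move: kk'; rewrite jk jk' => /eqP; rewrite -[X in X == _]addn0 -addn1 eqn_add2l.
congr (if _ then _ else _).
apply/vedgesP/existsP=> [[i [k [l [ik E]]]]|[i /existsP[k /andP[/eqP ik /eqP ->]]]].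
  exists i; apply/existsP; exists k; rewrite ik eqxx /=.
  have: (i, l) \in [set (i, j) | i in c] by rewrite E !inE eqxx.
  move=> /imsetP[_ _ [_ lj]]; rewrite -(inj_eq (imset_inj injj)) E lj.
  by rewrite imsetU !imset_set1.
by exists i, k, j; rewrite imsetU !imset_set1.
Qed.

Lemma psum_column (j : 'I_n) (C : {set 'I_m}) :
  psum block_weight ((pair^~ j) @: C) = path_poly C.
Proof.
rewrite psum_imset => [|i k []//].
by apply: eq_psum => b _ _; apply: block_weight_column.
Qed.

(** What remains to be matched once the columns before j are settled and the
vertices of column j in rows A are used by edges coming from the left. *)
Definition right_part (j : nat) A : {set vertex m n} :=
  [set v : vertex m n | (j < v.2)%N || (v.2 == j :> nat) && (v.1 \notin A)].

Lemma psum_last (j : 'I_n) A : j.+1 = n ->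
  psum block_weight (right_part j A) = path_poly (~: A).
Proof.
move=> jn; rewrite -(psum_column j); congr psum; apply/setP=> -[i k].
rewrite inE /=; have -> : (j < k)%N = false by apply/negbTE; rewrite -leqNgt -ltnS jn.
apply/andP/imsetP=> [[/eqP/val_inj -> iA]|[i' iA [-> ->]]].
  by exists i; rewrite ?inE.
by rewrite eqxx; split=> //; move: iA; rewrite inE.
Qed.

(** B is the set of rows whose horizontal edge from column j to column k is
used. Removing these edges leaves the vertical path part of column j and the
part of the grid from column k on, which no remaining block connects. *)
Lemma psum_step (j k : 'I_n) A : k = j.+1 :> nat ->
  psum block_weight (right_part j A) =
  \sum_B transfer A B * psum block_weight (right_part k B).
Proof.
move=> jk.
have jk_neq : (j == k) = false by rewrite -val_eqE /= jk ltn_eqF.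
pose dom i : {set vertex m n} := [set (i, j); (i, k)].
have in_dom i v : (v \in dom i) = (v.1 == i) && ((v.2 == j) || (v.2 == k)).
  by case: v => a c; rewrite !inE !xpair_eqE -andb_orr.
have dom_h i : dom i \in hedges m n by apply/hedgesP; exists i, j, k.
pose wd b := if b \in codom dom then block_weight b else 0.
pose wr b := if b \in codom dom then 0 else block_weight b.
have -> : psum block_weight (right_part j A) =
          psum (fun b => wd b + wr b) (right_part j A).
  by apply: eq_psum => b _ _; rewrite /wd /wr; case: ifP; rewrite ?addr0 ?add0r.
rewrite psumD (@big_psum_family _ _ _ dom) /=; first last.
- by move=> b; rewrite /wd; case: ifP; rewrite ?eqxx.
- by move=> i; apply/set0Pn; exists (i, j); rewrite in_dom !eqxx.
- move=> i i' ii'; rewrite -setI_eq0; apply/eqP/setP=> v.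
  rewrite in_setI !in_dom inE; apply/negP=> /andP[/andP[/eqP iv _] /andP[/eqP iv' _]].
  by rewrite -iv -iv' eqxx in ii'.
have in_doms B v : (v \in \bigcup_(i in B) dom i) =
    (v.1 \in B) && ((v.2 == j) || (v.2 == k)).
  apply/bigcupP/andP=> [[i iB]|[vB vjk]]; first by rewrite in_dom => /andP[/eqP->].
  by exists v.1; rewrite // in_dom eqxx.
have subE B : (\bigcup_(i in B) dom i \subset right_part j A) = [disjoint A & B].
  apply/subsetP/pred0P=> [sub i|dAB v].
    apply/negP=> /andP[/= iA iB].
    by have := sub (i, j); rewrite in_doms inE /= iB !eqxx ltnn iA => /(_ isT).
  rewrite in_doms inE => /andP[vB /orP[]/eqP ->]; last by rewrite jk leqnn.
  by rewrite eqxx /=; have /= := dAB v.1; rewrite vB andbT => ->; rewrite orbT.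
rewrite big_mkcond /=; apply: eq_bigr => B _.
rewrite subE /transfer; case: ifP => dAB; last by rewrite mul0r.
rewrite -mulrA; congr (_ * _).
  rewrite -prodr_const; apply: eq_bigr => i _.
  rewrite /wd codom_f /block_weight dom_h card_edge //.
  by rewrite inE dom_h.
set S := _ :\: _.
pose C : {set vertex m n} := [set v : vertex m n | v.2 == j].
have inS v : (v \in S) = if v.2 == j then (v.1 \notin A) && (v.1 \notin B)
                         else (j < v.2)%N && ~~ ((v.2 == k) && (v.1 \in B)).
  rewrite in_setD in_doms inE val_eqE.
  case: (v.2 =P j) => [->|_]; first by rewrite ltnn andbT andbC.
  by rewrite orbF andbC andbC [X in _ && ~~ X]andbC andbC.
have S_C : S :&: C = (pair^~ j) @: ~: (A :|: B).
  apply/setP=> -[i l]; rewrite in_setI inS inE /=.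
  apply/andP/imsetP=> [[iAB /eqP lj]|[i' i'AB [-> ->]]].
    by move: iAB; rewrite lj eqxx => iAB; exists i => //; rewrite !inE negb_or.
  by move: i'AB; rewrite eqxx !inE negb_or.
have SC : S :\: C = right_part k B.
  apply/setP=> -[i l]; rewrite in_setD inS !inE /=; case: (l =P j) => [->|lj] /=.
    by rewrite val_eqE jk_neq jk ltnNge leqnSn.
  have -> : (j < l)%N = (k < l)%N || (l == k).
    by rewrite -val_eqE /= jk leq_eqVlt orbC [X in _ || X]eq_sym.
  by rewrite -val_eqE /=; case: ltngtP.
have wr_dom b : b \notin codom dom -> wr b = block_weight b.
  by rewrite /wr => /negbTE ->.
rewrite (@psum_split _ _ wr C) ?SC ?S_C => [|b bS].
  congr (_ * _).
    rewrite -(psum_column j); apply: eq_psum => b _ bj; apply: wr_dom.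
    apply/codomP=> -[i E]; move: bj; rewrite E => /subsetP/(_ (i, k)).
    rewrite in_dom !eqxx orbT => /(_ isT) /imsetP[_ _ [_ kj]].
    by rewrite kj eqxx in jk_neq.
  apply: eq_psum => b _ bj; apply: wr_dom.
  apply/codomP=> -[i E]; move: bj; rewrite E => /subsetP/(_ (i, j)).
  by rewrite in_dom !eqxx inE /= jk ltnNge leqnSn ltn_eqF // => /(_ isT).
rewrite /wr; case: ifPn => [|b_dom]; rewrite ?eqxx // /block_weight.
have two (u v : vertex m n) : (u.2 == v.2) ->
    ([set u; v] \subset C) || [disjoint [set u; v] & C].
  move=> uv; case: (boolP (u.2 == j)) => uj.
    by rewrite !subUset !sub1set !inE -(eqP uv) uj.
  by rewrite orbC disjoints_subset subUset !sub1set !inE -(eqP uv) uj.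
case: ifP => [/cards1P[v ->] _|_].
  by have := two v v (eqxx _); rewrite setUid.
(* A horizontal edge touching column j would join it to column k, and so lie
   in the family dom, or come from the left of S. *)
case: ifP => [/hedgesP[i [l [l' [ll' E]]]] _|_].
  move: bS b_dom; rewrite E subUset !sub1set !inS /= => /andP[il_S _] b_dom.
  rewrite orbC disjoints_subset subUset !sub1set !inE -!val_eqE /=.
  have lj : l != j.
    apply: contraNneq b_dom => lj; apply/codomP; exists i.
    by rewrite /dom lj; congr [set _; (_, _)]; apply: val_inj; rewrite /= ll' lj jk.
  move: il_S; rewrite (negPf lj) => /andP[jl _].
  by rewrite ll' !gtn_eqF // ltnS ltnW.
case: ifP => [/vedgesP[i [i' [l [ii' ->]]]] _|]; last by rewrite eqxx.
by apply: two.
Qed.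

End Grid.
End Transfer.

(** A matching becomes a set partition by adding its isolated vertices as
blocks; the sum on the left is organised by the set B of isolated vertices. *)
Lemma matching_poly_psum m n : (0 < n)%N ->
  matching_poly m n = psum (@block_weight _ m 'X_0 'X_1 'X_2 n) setT.
Proof.
case: n => // n _; rewrite /matching_poly /=.
pose E := hedges m n.+1 :|: vedges m n.+1.
pose ws (b : {set vertex m n.+1}) : {mpoly rat[3]} := if #|b| == 1 then 'X_2 else 0.
pose we b : {mpoly rat[3]} := if b \in hedges m n.+1 then 'X_0
  else if b \in vedges m n.+1 then 'X_1 else 0.
transitivity (psum (fun b => ws b + we b) setT); last first.
  apply: eq_psum => b _ _; rewrite /block_weight /ws; case: ifP; rewrite ?add0r // => b1.
  suff -> : we b = 0 by rewrite addr0.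
  have := @card_edge _ _ b; rewrite (eqP b1) /we inE.
  by case: (b \in hedges _ _) => [/(_ isT)|]; case: (b \in vedges _ _) => // /(_ isT).
rewrite psumD (@big_psum_family _ _ _ (fun v => [set v])) /=; first last.
- by move=> b; rewrite /ws; case: ifP => [/cards1P[v ->] _|]; rewrite ?eqxx ?codom_f.
- by move=> v; apply/set0Pn; exists v; rewrite inE.
- by move=> u v; rewrite disjoints1 inE.
rewrite (partition_big (@isolated m n.+1) predT) //=.
apply: eq_big => [B|B _]; first by rewrite subsetT.
have -> : \bigcup_(v in B) [set v] = B.
  apply/setP=> v; apply/bigcupP/idP=> [[u uB]|vB]; first by rewrite inE => /eqP ->.
  by exists v; rewrite ?inE.
rewrite (_ : \prod_(i in B) _ = 'X_2 ^+ #|B|); last first.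
  by rewrite -prodr_const; apply: eq_bigr => v _; rewrite /ws cards1.
rewrite /psum mulr_sumr [RHS](bigID (fun M : {set {set _}} => M \subset E)) /=.
rewrite [X in _ + X]big1 ?addr0 => [|M /andP[_ /subsetPn[b bM]]]; last first.
  rewrite inE negb_or /E => /andP[/negbTE bh /negbTE bv].
  by rewrite (bigD1 b) //= /we bh bv mul0r mulr0.
apply: eq_big => [M|M /andP[/andP[ME tM] /eqP MB]].
  have -> : (isolated M == B) = (cover M == setT :\: B).
    by rewrite setTD /isolated; apply/eqP/eqP=> [<-|->]; rewrite setCK.
  rewrite /matching /partition -/E [in RHS]andbC andbAC -andbA.
  case ME: (M \subset E) => //=; suff -> : set0 \notin M by rewrite andbT andbC.
  apply: contraTN ME => M0; apply/subsetPn; exists set0 => //.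
  by apply/negP=> /card_edge; rewrite cards0.
rewrite /weight MB mulrC; congr (_ * _).
rewrite (big_setID (hedges m n.+1)) /=; congr (_ * _).
  by rewrite -prodr_const; apply: eq_bigr => b /setIP[_ bh]; rewrite /we bh.
have -> : M :&: vedges m n.+1 = M :\: hedges m n.+1.
  apply/setP=> b; rewrite !inE; case bM : (b \in M); rewrite ?andbF //=.
  have := subsetP ME _ bM; rewrite !inE andbT.
  by case bh : (b \in hedges _ _) => //= _; apply/negbTE/hedges_not_vedges.
rewrite -prodr_const; apply: eq_bigr => b /setDP[bM bh].
by have := subsetP ME _ bM; rewrite inE /we (negPf bh) /= => ->.
Qed.

(** * Inversion of the transfer matrix *)

Section TransferInverse.
Variables (R : comNzRingType) (m : nat) (x y z : R).
Implicit Types A B C : {set 'I_m}.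

Lemma path_poly_opp (S : {set 'I_m}) :
  path_poly (- y) (- z) S = psum (fun b => - path_weight y z b) S.
Proof.
apply: eq_psum => b _ _; rewrite /path_weight.
by do 2![case: ifP => // _]; rewrite oppr0.
Qed.

(** The nonzero terms have ~: C \subset B \subset ~: A, and
D := C :&: B then ranges over the subsets of C :\: A. The powers of x combine to
x^m, and what is left is the product of [path_poly] with its inverse, evaluated
at C :\: A. *)
Lemma transfer_inverse A C :
  \sum_B transfer x (- y) (- z) A B * transfer x y z (~: C) (~: B)
    = x ^+ m *+ (A == C).
Proof.
transitivity (\sum_(B : {set 'I_m} | (~: C \subset B) && (B \subset ~: A))
    x ^+ m * (path_poly y z (C :&: B) * path_poly (- y) (- z) ((C :\: A) :\: (C :&: B)))).
  rewrite [RHS]big_mkcond; apply: eq_bigr => B _.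
  rewrite /transfer disjoint_sym disjoints_subset [[disjoint ~: C & _]]disjoints_subset.
  rewrite setCK; case: ifP => BA; last by rewrite andbF mul0r.
  case: ifP => CB; last by rewrite mulr0.
  rewrite mulrACA -exprD cardsC card_ord [X in _ * X = _]mulrC.
  congr (_ * (_ * _)); congr path_poly; first by rewrite setCU !setCK.
  apply/setP=> i; have := subsetP CB i; rewrite !inE negb_and.
  by case: (i \in A); case: (i \in B); case: (i \in C) => //= /(_ isT).
rewrite -mulr_sumr -[x ^+ m in RHS]mulr1 -mulrnAr; congr (_ * _).
have [AC|AC] := boolP (A \subset C); last first.
  rewrite big_pred0 => [|B]; first by case: eqVneq AC => // ->; rewrite subxx.
  apply/negbTE; apply: contra AC => /andP[CB BA].
  by rewrite -setCS (subset_trans CB).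
have -> : (A == C) = (C :\: A == set0) by rewrite setD_eq0 eqEsubset AC.
rewrite -(@psum0 _ R (C :\: A)).
rewrite (reindex_onto (fun D => ~: C :|: D) (fun B => C :&: B)) /=; last first.
  move=> B /andP[CB _]; apply/setP=> i; have := subsetP CB i; rewrite !inE.
  by case: (i \in C) => //= ->.
transitivity (psum (fun b => path_weight y z b + - path_weight y z b) (C :\: A)).
  rewrite psumD; apply: eq_big => [D|D /andP[_ /eqP ->]]; last by rewrite path_poly_opp.
  rewrite subsetUl subUset setCS AC /= setIUr setICr set0U subsetD -disjoints_subset.
  by rewrite (sameP eqP setIidPr) andbC.
by apply: eq_psum => b _ _; rewrite subrr.
Qed.
End TransferInverse.

(** * Matching polynomials as entries of matrix powers *)

Section TransferMatrix.
Variable m : nat.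

Definition set_mx (R : pzSemiRingType) (f : {set 'I_m} -> {set 'I_m} -> R) :
    'M[R]_#|{set 'I_m}| :=
  \matrix_(a, b) f (enum_val a) (enum_val b).

Lemma set_mxE (R : pzSemiRingType) (f : {set 'I_m} -> {set 'I_m} -> R) A B :
  set_mx f (enum_rank A) (enum_rank B) = f A B.
Proof. by rewrite mxE !enum_rankK. Qed.

Lemma big_set_index (R : nmodType) (F : {set 'I_m} -> R) :
  \sum_(b < #|{set 'I_m}|) F (enum_val b) = \sum_B F B.
Proof. by rewrite [RHS](reindex _ (onW_bij _ (@enum_val_bij _))). Qed.

Variables (R : comNzRingType) (x y z : R).

Definition transfer_mx := set_mx (transfer x y z).

Lemma psum_right_part n k (j : 'I_n) A : (j + k.+1)%N = n ->
  psum (block_weight x y z (n := n)) (right_part n j A) =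
  (transfer_mx ^+ k.+1) (enum_rank A) (enum_rank set0).
Proof.
elim: k j A => [|k IHk] j A jk.
  rewrite addn1 in jk; rewrite psum_last // expr1 set_mxE /transfer.
  by rewrite disjoints_subset setC0 subsetT cards0 mul1r setU0.
have j1n : (j.+1 < n)%N by have := leq_addr k j.+1; rewrite -ltnS -addnS addSnnS jk.
rewrite (@psum_step _ _ _ _ _ _ j (Ordinal j1n)) // exprS mxE -big_set_index.
apply: eq_bigr => b _; rewrite IHk ?enum_valK; last by rewrite /= addSnnS.
by rewrite mxE enum_rankK.
Qed.
End TransferMatrix.

Lemma matching_poly_transfer m n :
  matching_poly m n =
    (transfer_mx m 'X_0 'X_1 'X_2 ^+ n) (enum_rank set0) (enum_rank set0).
Proof.
case: n => [|n]; first by rewrite expr0 mxE eqxx.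
rewrite matching_poly_psum // -(@psum_right_part _ _ _ _ _ n.+1 n ord0) //.
by congr psum; apply/setP=> v; rewrite !inE andbT lt0n orNb.
Qed.

(** * Rational functions determined by their expansion *)

Local Notation "p %:F" := (FracField.tofrac p) : ring_scope.

(** Writing f for the power series too, P * Q' = Q * f * Q' = P' * Q; each
coefficient only involves a truncation of f. *)
Lemma expansion_at0_unique F F' f :
  expansion_at0 F f -> expansion_at0 F' f -> F = F'.
Proof.
move=> [P [Q [Q0 -> E]]] [P' [Q' [Q'0 -> E']]].
have nz (p : {poly {mpoly rat[3]}}) : p`_0 != 0 -> p != 0.
  by apply: contraNneq => ->; rewrite coef0.
apply/eqP; rewrite eqr_div ?tofrac_eq0 ?nz // -!tofracM tofrac_eq; apply/eqP.
apply/polyP=> n; pose fn := \poly_(i < n.+1) f i.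
have trunc (p q : {poly {mpoly rat[3]}}) i : (i <= n)%N ->
    (forall k, \sum_(l < k.+1) q`_l * f (k - l)%N = p`_k) -> (q * fn)`_i = p`_i.
  move=> lin <-; rewrite coefM; apply: eq_bigr => l _.
  by rewrite coef_poly ltnS (leq_trans (leq_subr _ _) lin).
transitivity ((Q * fn * Q')`_n).
  by rewrite !coefM; apply: eq_bigr => i _; rewrite (trunc P) // -ltnS.
have -> : Q * fn * Q' = Q' * fn * Q by rewrite -mulrA mulrC [fn * Q']mulrC.
by rewrite !coefM; apply: eq_bigr => i _; rewrite (trunc P') // -ltnS.
Qed.

(** * Reciprocity for resolvents *)

Section Resolvent.
Variables (K : fieldType) (N : nat) (T T' : 'M[K]_N) (c : 'I_N -> 'I_N) (e : 'I_N).
Variables (t X : K) (G G' : 'M[K]_N).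
Hypotheses (cK : involutive c) (ce : c e != e).
Hypotheses (t0 : t != 0) (X0 : X != 0).
Hypothesis T'U : forall a b, \sum_k T' a k * T (c b) (c k) = X *+ (a == b).
Hypothesis T_row : forall b, T (c e) b = (b == e)%:R.
Hypothesis T_col : forall a, T a (c e) = X *+ (a == e).
Hypothesis GE : G *m (1%:M - t *: T) = 1%:M.
Hypothesis G'E : G' *m (1%:M - (t * X)^-1 *: T') = 1%:M.

(** Let U be the transpose of T relabelled by c, so that T' U = X, and let
Gc = (1 - t U)^-1, the transpose of G relabelled by c. The resolvent of T' at
1 / (t X) is - t U Gc = 1 - Gc. Its (e, e) entry involves G (c e) (c e), which is
computed by expanding G once on each side, since T has a single nonzero entry
in row c e and in column c e. *)
Lemma resolvent_reciprocity : X * t ^+ 2 * G e e = - G' e e.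
Proof.
pose U := mxsub c c T^T; pose Gc := mxsub c c G^T.
have T'UE : T' *m U = X%:M.
  by apply/matrixP=> a b; rewrite !mxE -T'U; apply: eq_bigr => k _; rewrite !mxE.
have GcE : (1%:M - t *: U) *m Gc = 1%:M.
  apply/matrixP=> a b; have /matrixP/(_ (c b) (c a)) := GE.
  rewrite !mxE (inj_eq (inv_inj cK)) eq_sym => <-.
  rewrite (reindex_inj (inv_inj cK)); apply: eq_bigr => k _.
  by rewrite !mxE !cK [a == _]eq_sym (inv_eq cK) mulrC.
have E : G' = 1%:M - Gc.
  have : (1%:M - (t * X)^-1 *: T') *m (1%:M - Gc) = 1%:M.
    have -> : 1%:M - Gc = - (t *: (U *m Gc)).
      by rewrite -[X in X - _]GcE mulmxBl mul1mx -scalemxAl addrC addKr.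
    rewrite mulmxBl mul1mx mulmxN -scalemxAl -scalemxAr mulmxA T'UE mul_scalar_mx.
    rewrite !scalerA opprK -[RHS]GcE mulmxBl mul1mx -scalemxAl addrC.
    by rewrite mulVf ?mulf_neq0 // scale1r.
  by move/(congr1 (mulmx G')); rewrite mulmxA G'E mul1mx mulmx1.
have GT : G = 1%:M + t *: (G *m T).
  by rewrite -GE mulmxBr mulmx1 -scalemxAr subrK.
have TG : G = 1%:M + t *: (T *m G).
  by rewrite -(mulmx1C GE) mulmxBl mul1mx -scalemxAl subrK.
have Guu : G (c e) (c e) = 1 + t * G e (c e).
  rewrite {1}TG !mxE eqxx; congr (_ + _ * _).
  rewrite (bigD1 e) //= T_row eqxx mul1r big1 ?addr0 // => k ke.
  by rewrite T_row (negPf ke) mul0r.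
have Geu : G e (c e) = t * (X * G e e).
  rewrite {1}GT !mxE eq_sym (negPf ce) add0r; congr (_ * _).
  rewrite (bigD1 e) //= T_col eqxx mulrC big1 ?addr0 // => k ke.
  by rewrite T_col (negPf ke) mulr0.
by rewrite E !mxE eqxx Guu Geu opprB addrC addKr expr2 -!mulrA mulrCA (mulrCA X).
Qed.
End Resolvent.

(** * The generating function as a resolvent entry *)

Section TransferEntries.
Variables (m : nat) (R : comNzRingType) (x y z : R).

Lemma map_transfer_mx (R' : comNzRingType) (f : {rmorphism R -> R'}) :
  map_mx f (transfer_mx m x y z) = transfer_mx m (f x) (f y) (f z).
Proof.
apply/matrixP=> a b; rewrite !mxE /transfer; case: ifP => _; last exact: rmorph0.
rewrite rmorphM rmorphXn /= rmorph_psum; congr (_ * _); apply: eq_psum => c _ _.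
by rewrite /path_weight; do 2![case: ifP => // _]; rewrite rmorph0.
Qed.

Lemma transfer_setT_l B : transfer x y z setT B = (B == set0 :> {set 'I_m})%:R.
Proof.
rewrite /transfer disjoint_sym disjoints_subset setCT subset0.
by case: eqP => // ->; rewrite cards0 mul1r setTU setCT /path_poly psum_set0.
Qed.

Lemma transfer_setT_r A : transfer x y z A setT = x ^+ m *+ (A == set0 :> {set 'I_m}).
Proof.
rewrite /transfer disjoints_subset setCT subset0.
by case: eqP => // ->; rewrite cardsT card_ord setUT setCT /path_poly psum_set0 mulr1.
Qed.
End TransferEntries.

Lemma geometric_mx (R : comNzRingType) N (T : 'M[R]_N) n :
  (1%:M - 'X *: map_mx polyC T) *m (\sum_(k < n) 'X^k *: map_mx polyC (T ^+ k))
    = 1%:M - 'X^n *: map_mx polyC (T ^+ n).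
Proof.
elim: n => [|n IHn]; first by rewrite big_ord0 mulmx0 !expr0 map_mx1 scale1r subrr.
rewrite big_ord_recr mulmxDr IHn mulmxBl mul1mx addrA subrK /=.
by rewrite -scalemxAl -scalemxAr scalerA -map_mxM -exprS [T ^+ n.+1]exprS.
Qed.

(** The reversed characteristic matrix 1 - 'X T, invertible as a power series
in 'X. *)
Definition rev_char_mx (R : comNzRingType) N (T : 'M[R]_N) : 'M[{poly R}]_N :=
  1%:M - 'X *: map_mx polyC T.

Lemma det_rev_char_mx0 (R : comNzRingType) N (T : 'M[R]_N) :
  (\det (rev_char_mx T))`_0 = 1.
Proof.
rewrite -horner_coef0 -[LHS]/(horner_eval 0 _) -det_map_mx.
suff -> : map_mx (horner_eval 0) (rev_char_mx T) = 1%:M by rewrite det1.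
apply/matrixP=> a b; rewrite !mxE /horner_eval hornerD hornerN hornerM hornerX mul0r.
by rewrite subr0 -[1 in LHS]polyC1 hornerMn hornerC.
Qed.

(** With A = 1 - 'X T, this is \adj A = \det A * A^-1 read off coefficientwise.
The geometric series for A^-1 is cut after n + 1 terms, which alters only
coefficients of degree greater than n. *)
Lemma coef_adj_rev_char_mx (R : comNzRingType) N (T : 'M[R]_N) i j n :
  \sum_(k < n.+1) (\det (rev_char_mx T))`_k * (T ^+ (n - k)) i j
    = ((\adj (rev_char_mx T)) i j)`_n.
Proof.
pose v := \sum_(k < n.+1) 'X^k *: map_mx polyC (T ^+ k).
have Av : rev_char_mx T *m v = 1%:M - 'X^(n.+1) *: map_mx polyC (T ^+ n.+1).
  exact: geometric_mx.
have : (\adj (rev_char_mx T) *m (rev_char_mx T *m v)) i j =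
       (\adj (rev_char_mx T)) i j - 'X^(n.+1) *
         (\adj (rev_char_mx T) *m map_mx polyC (T ^+ n.+1)) i j.
  by rewrite Av mulmxBr mulmx1 -scalemxAr !mxE.
rewrite mulmxA mul_adj_mx mul_scalar_mx mxE => /(congr1 (fun p : {poly _} => p`_n)).
rewrite coefB coefXnM ltnSn subr0 => <-.
have -> : v i j = \poly_(k < n.+1) (T ^+ k) i j.
  rewrite /v summxE poly_def; apply: eq_bigr => k _.
  by rewrite !mxE mulrC mul_polyC.
rewrite coefM; apply: eq_bigr => k _; congr (_ * _).
by rewrite coef_poly ltnS leq_subr.
Qed.

Definition grid_transfer m : 'M[{mpoly rat[3]}]_#|{set 'I_m}| :=
  transfer_mx m 'X_0 'X_1 'X_2.

Definition genfun_num m :=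
  (\adj (rev_char_mx (grid_transfer m))) (enum_rank set0) (enum_rank set0).
Definition genfun_den m := \det (rev_char_mx (grid_transfer m)).

Lemma expansion_at0_genfun m :
  expansion_at0 ((genfun_num m)%:F / (genfun_den m)%:F) (matching_poly m).
Proof.
exists (genfun_num m), (genfun_den m); split=> //.
  by rewrite det_rev_char_mx0 oner_neq0.
move=> n; rewrite -coef_adj_rev_char_mx.
by apply: eq_bigr => k _; rewrite matching_poly_transfer.
Qed.

Lemma is_genfunP m F :
  is_genfun m F -> F = (genfun_num m)%:F / (genfun_den m)%:F.
Proof. by move/expansion_at0_unique; apply; apply: expansion_at0_genfun. Qed.

(** * Injectivity of the substitution *)

Section Substitution.
Variables t x y z : ratfun.

Let coef_subst := mmap (@FracField.tofrac _ \o polyC \o @mpolyC 3 rat)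
  (tnth [tuple x; y; z]).

HB.instance Definition _ := GRing.RMorphism.copy (poly_subst t x y z)
  (horner_eval t \o map_poly coef_subst).

Lemma poly_substX : poly_subst t x y z 'X = t.
Proof. by rewrite /poly_subst map_polyX hornerX. Qed.

Lemma poly_subst_var :
  [/\ poly_subst t x y z ('X_0)%:P = x, poly_subst t x y z ('X_1)%:P = y
    & poly_subst t x y z ('X_2)%:P = z].
Proof. by split; rewrite /poly_subst map_polyC hornerC /= mmapX mmap1U. Qed.
End Substitution.

Lemma mpolyX_neq0 (d : 'X_{1..3}) : 'X_[d] != 0 :> {mpoly rat[3]}.
Proof. by rewrite -msupp_eq0 msuppX. Qed.

Lemma tR_neq0 : tR != 0.
Proof. by rewrite tofrac_eq0 polyX_eq0. Qed.

Lemma xR_neq0 : xR != 0.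
Proof. by rewrite tofrac_eq0 polyC_eq0 mpolyX_neq0. Qed.

Section FlipSigns.
Let signed_vars : 3.-tuple {mpoly rat[3]} := [tuple 'X_0; - 'X_1; - 'X_2].
Definition flip_yz (p : {mpoly rat[3]}) := p \mPo signed_vars.

(** Flipping signs is an involution. *)
Lemma flip_yz_inj : injective flip_yz.
Proof.
apply: can_inj (flip_yz) _ => p; rewrite /flip_yz (comp_mpolyEX p).
rewrite [RHS]mpolyE [LHS]raddf_sum.
apply: eq_bigr => d _ /=; rewrite !comp_mpolyZ; congr (_ *: _).
rewrite comp_mpolyX rmorph_prod mpolyXE_id; apply: eq_bigr => i _.
rewrite rmorphXn; congr (_ ^+ _).
case: i => [[|[|[|//]]] ?]; rewrite (tnth_nth 0) /= ?rmorphN /= !comp_mpolyXU //=.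
  by rewrite opprK; congr 'X_ _; apply: val_inj.
by rewrite opprK; congr 'X_ _; apply: val_inj.
Qed.

Lemma coef_subst_flip p :
  mmap (@FracField.tofrac _ \o polyC \o @mpolyC 3 rat)
    (tnth [tuple xR; - yR; - zR]) p = (flip_yz p)%:P%:F.
Proof.
rewrite /flip_yz /comp_mpoly /mmap !rmorph_sum; apply: eq_bigr => d _ /=.
rewrite 2!rmorphM; congr (_ * _); rewrite !rmorph_prod; apply: eq_bigr => i _.
rewrite !rmorphXn; congr (_ ^+ _).
by case: i => [[|[|[|//]]] ?]; rewrite !(tnth_nth 0) /= ?rmorphN.
Qed.

(** This is the independence required by [rat_substE]. Multiplied by
(t x^m)^(size r), the value of r becomes a polynomial in t whose coefficients
are those of r in reverse order, up to sign flips and powers of x. *)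
Lemma poly_subst_inj m r :
  poly_subst (1 / (tR * xR ^+ m)) xR (- yR) (- zR) r = 0 -> r = 0.
Proof.
set u := tR * _; have u0 : u != 0.
  exact: mulf_neq0 tR_neq0 (expf_neq0 m xR_neq0).
move=> /(congr1 ( *%R (u ^+ size r))); rewrite mulr0 /poly_subst /map_poly horner_poly.
pose g i := flip_yz r`_i * 'X_0 ^+ (m * (size r - i)).
have -> : u ^+ size r * (\sum_(i < size r)
     mmap (@FracField.tofrac _ \o polyC \o @mpolyC 3 rat)
      (tnth [tuple xR; - yR; - zR]) r`_i * (1 / u) ^+ i) =
   (\sum_(i < size r) (g i)%:P * 'X^(size r - i))%:F.
  rewrite mulr_sumr rmorph_sum; apply: eq_bigr => i _ /=.
  rewrite coef_subst_flip mulrCA div1r exprVn -expfB // exprMn -exprM.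
  rewrite /g polyCM polyC_exp !tofracM !tofracXn -mulrA; congr (_ * _).
  by rewrite mulrC.
move=> /eqP; rewrite tofrac_eq0 => /eqP sum0.
apply/polyP=> i; rewrite coef0; case: (ltnP i (size r)) => ir; last first.
  by rewrite nth_default.
have /(congr1 (fun p : {poly _} => p`_(size r - i))) := sum0.
rewrite coef0 coef_sum (bigD1 (Ordinal ir)) //= big1 ?addr0 => [|k ki].
  rewrite coefCM coefXn eqxx mulr1 => /eqP.
  rewrite mulf_eq0 expf_eq0 (negPf (mpolyX_neq0 _)) andbF orbF => /eqP fr.
  by apply: flip_yz_inj; rewrite fr /flip_yz comp_mpoly0.
rewrite coefCM coefXn; case: eqP => [E|_]; last by rewrite mulr0.
case/eqP: ki; apply: val_inj => /=; apply/eqP; rewrite eq_sym.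
by rewrite -(eqn_sub2lE (ltnW ir) (ltnW (ltn_ord k))) E.
Qed.
End FlipSigns.

(** Used twice: for the embedding into rational functions and for the
substitution of the reciprocity law. *)
Lemma genfun_resolvent (K : fieldType) m
    (f : {rmorphism {poly {mpoly rat[3]}} -> K}) :
    f (genfun_den m) != 0 ->
  exists2 G : 'M[K]_#|{set 'I_m}|,
    G *m (1%:M - f 'X *: transfer_mx m (f ('X_0)%:P) (f ('X_1)%:P) (f ('X_2)%:P)) = 1%:M
    & f (genfun_num m) / f (genfun_den m) = G (enum_rank set0) (enum_rank set0).
Proof.
have <- : map_mx f (rev_char_mx (grid_transfer m)) =
    1%:M - f 'X *: transfer_mx m (f ('X_0)%:P) (f ('X_1)%:P) (f ('X_2)%:P).
  have -> : transfer_mx m (f ('X_0)%:P) (f ('X_1)%:P) (f ('X_2)%:P) =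
      map_mx f (map_mx polyC (grid_transfer m)).
    by rewrite !map_transfer_mx.
  by rewrite -map_mxZ -(map_mx1 f) -map_mxB.
rewrite /genfun_den -det_map_mx => den0.
exists ((\det (map_mx f (rev_char_mx (grid_transfer m))))^-1 *:
        \adj (map_mx f (rev_char_mx (grid_transfer m)))).
  by rewrite -scalemxAl mul_adj_mx scale_scalar_mx mulVf.
by rewrite mxE mulrC -map_mx_adj mxE.
Qed.

(** * The reciprocity theorem *)

Theorem theorem3 (m : nat) (m_ge1 : (1 <= m)%N) :
  (exists F : ratfun, is_genfun m F) /\
  (forall F : ratfun, is_genfun m F ->
     xR ^+ m * tR ^+ 2 * F
       = - rat_subst (1 / (tR * xR ^+ m)) xR (- yR) (- zR) F).
Proof.
split=> [|F /is_genfunP ->]; first by eexists; apply: expansion_at0_genfun.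
have den0 : genfun_den m != 0.
  apply: contraNneq (oner_neq0 {mpoly rat[3]}) => d0.
  by rewrite -(det_rev_char_mx0 (grid_transfer m)) -/(genfun_den m) d0 coef0.
rewrite rat_substE //; last exact: poly_subst_inj.
have xRm0 : xR ^+ m != 0 := expf_neq0 m xR_neq0.
have fden0 : (genfun_den m)%:F != 0 by rewrite tofrac_eq0.
have sden0 : poly_subst (1 / (tR * xR ^+ m)) xR (- yR) (- zR) (genfun_den m) != 0.
  by apply: contra den0 => /eqP/poly_subst_inj ->.
have [G GE ->] := genfun_resolvent fden0.
have [G' G'E ->] := genfun_resolvent sden0.
have [sx sy sz] := poly_subst_var (1 / (tR * xR ^+ m)) xR (- yR) (- zR).
rewrite /= poly_substX sx sy sz div1r in G'E.
(* Complementation of subsets, on their indices. *)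
pose c (a : 'I_#|{set 'I_m}|) := enum_rank (~: enum_val a).
have ce : c (enum_rank set0) = enum_rank setT by rewrite /c enum_rankK setC0.
apply: (resolvent_reciprocity (T := transfer_mx m xR yR zR) (c := c)
  _ _ tR_neq0 xRm0 _ _ _ GE G'E).
- by move=> a; rewrite /c enum_rankK setCK enum_valK.
- by rewrite ce (inj_eq enum_rank_inj) -cards_eq0 cardsT card_ord -lt0n.
- move=> a b; transitivity (\sum_(k < #|{set 'I_m}|)
    transfer xR (- yR) (- zR) (enum_val a) (enum_val k) *
    transfer xR yR zR (~: enum_val b) (~: enum_val k)).
    by apply: eq_bigr => k _; rewrite !mxE /c !enum_rankK.
  rewrite (big_set_index (fun B => transfer xR (- yR) (- zR) (enum_val a) B *
    transfer xR yR zR (~: enum_val b) (~: B))).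
  by rewrite transfer_inverse (inj_eq enum_val_inj).
- by move=> b; rewrite ce mxE enum_rankK transfer_setT_l (can2_eq enum_valK enum_rankK).
- by move=> a; rewrite ce mxE enum_rankK transfer_setT_r (can2_eq enum_valK enum_rankK).
Qed.
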